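(* Assume that the KKT solution set $\Omega^*$ is nonempty and that $\mathcal P_f\succeq0$, $\mathcal P_g\succeq0$, $\mathcal P_f+\sigma A^*A\succ0$, $\mathcal P_g+\sigma B^*B\succ0$. Let $\beta\in(0,1)$ be such that for every $w_1,w_2\in\mathbb H$, with $\Delta w:=w_1-w_2$ and $\Delta\mathcal F_{sm}:=\mathcal F_{sm}(w_1)-\mathcal F_{sm}(w_2)$, $$\Delta\mathcal F_{sm}\in\operatorname{Im}(\mathcal M)\qquad\text{and}\qquad\langle\Delta\mathcal F_{sm},\Delta w\rangle\ge\frac1{2\beta}\|\Delta\mathcal F_{sm}\|_{\mathcal M^\dagger}^2 .$$ Then, for every $w^0\in\mathbb H$, the sequence generated by $w^{k+1}=\mathbf Tw^k$, $k=0,1,\dots$, converges in the ambient norm of $\mathbb H$ to a point $w^*\in\Omega^*$.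
   Context: **Setting.** $\mathbb X,\mathbb Y,\mathbb Z$ are finite-dimensional Euclidean spaces, each with an inner product $\langle\cdot,\cdot\rangle$ and induced norm $\|\cdot\|$; $\mathbb H:=\mathbb Y\times\mathbb Z\times\mathbb X$ carries the product inner product (whose norm is the ambient norm), with elements $w=(y,z,x)$. $p:\mathbb Y\to(-\infty,+\infty]$ and $q:\mathbb Z\to(-\infty,+\infty]$ are closed proper convex; $f:\mathbb Y\to\mathbb R$ and $g:\mathbb Z\to\mathbb R$ are convex and differentiable with Lipschitz continuous gradients; $A:\mathbb Y\to\mathbb X$, $B:\mathbb Z\to\mathbb X$ are linear with adjoints $A^*,B^*$; $c\in\mathbb X$. The problem is $\min_{y,z}\ p(y)+f(y)+q(z)+g(z)$ subject to $Ay+Bz=c$. For a self-adjoint linear operator $\Sigma$, $\|v\|_\Sigma^2:=\langle v,\Sigma v\rangle$; $\Sigma\succeq0$ (resp. $\succ0$) means positive semidefinite (resp. definite); $\operatorname{Im}(\Sigma)$ is the range and $\Sigma^\dagger$ the Moore--Penrose pseudoinverse. **Majorization.** $\widehat\Sigma_f$ on $\mathbb Y$ and $\widehat\Sigma_g$ on $\mathbb Z$ are self-adjoint positive semidefinite linear operators such that for all $y,y'\in\mathbb Y$, $z,z'\in\mathbb Z$: $f(y)\le f(y')+\langle\nabla f(y'),y-y'\rangle+\tfrac12\|y-y'\|_{\widehat\Sigma_f}^2$ and $g(z)\le g(z')+\langle\nabla g(z'),z-z'\rangle+\tfrac12\|z-z'\|_{\widehat\Sigma_g}^2$. Let $\sigma>0$,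 let $\mathcal S$ on $\mathbb Y$ and $\mathcal T$ on $\mathbb Z$ be self-adjoint linear operators (not necessarily semidefinite), and set $\mathcal P_f:=\mathcal S+\widehat\Sigma_f$, $\mathcal P_g:=\mathcal T+\widehat\Sigma_g$. **Operators on $\mathbb H$.** With $\partial$ the convex subdifferential, $$\mathcal R_{ns}(w)=\begin{pmatrix}\partial p(y)+A^*x\\ \partial q(z)+B^*x\\ -Ay-Bz+c\end{pmatrix},\quad \mathcal F_{sm}(w)=\begin{pmatrix}\nabla f(y)\\ \nabla g(z)\\ 0\end{pmatrix},\quad \mathcal R=\mathcal R_{ns}+\mathcal F_{sm},$$ $$\mathcal M=\begin{pmatrix}\mathcal P_f+\sigma A^*A&0&A^*\\ 0&\mathcal P_g&0\\ A&0&\sigma^{-1}I\end{pmatrix}.$$ The KKT solution set is $\Omega^*:=\{w\in\mathbb H:0\in\mathcal R_{ns}(w)+\mathcal F_{sm}(w)\}$. **The mapping $\mathbf T=(\mathcal M+\mathcal R_{ns})^{-1}(\mathcal M-\mathcal F_{sm})$.** $\mathbf T(w)$ is the point $w^+\in\mathbb H$ with $\mathcal Mw-\mathcal F_{sm}(w)\in\mathcal Mw^++\mathcal R_{ns}(w^+)$; under the stated positive (semi)definiteness hypotheses such a $w^+$ exists and is unique for every $w\in\mathbb H$, so $\mathbf T:\mathbb H\to\mathbb H$ is well defined. *)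

(* Defs.v *)
From HB Require Import structures.
From mathcomp Require Import all_boot all_order all_algebra.
From mathcomp Require Import all_classical all_reals all_analysis.
From mathcomp Require Import sesquilinear.

Set Implicit Arguments.
Unset Strict Implicit.
Unset Printing Implicit Defensive.

Import Order.TTheory GRing.Theory Num.Theory.
Import numFieldNormedType.Exports.

Local Open Scope classical_set_scope.
Local Open Scope ring_scope.

(* Finite-dimensional real inner product space: [Vector] gives finite dimension
   and [NormedModule] the topology, whose norm is induced by [inner]. *)
HB.mixin Record isEuclidean (R : realType) E
    & Vector R E & NormedModule R E := {
  inner : {dot E for (@idfun R)} ;
  normE_inner : forall x : E, `|x| = Num.sqrt (inner x x)
}.

#[short(type="euclideanType")]
HB.structure Definition Euclidean (R : realType) :=
  {E of Vector R E & NormedModule R E & isEuclidean R E}.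

Notation "'[ u , v ]" := (inner u v) : ring_scope.

Section operators.
Context {R : realType}.

Section one_space.
Variables (V : vectType R) (d : {dot V for idfun}).

Definition self_adjoint (S : 'End(V)) : Prop :=
  forall u v, d (S u) v = d u (S v).

Definition psd (S : 'End(V)) : Prop := forall v, 0 <= d v (S v).

Definition pd (S : 'End(V)) : Prop := forall v, v != 0 -> 0 < d v (S v).

Definition sqnorm (S : 'End(V)) (v : V) : R := d v (S v).

(* the four Penrose conditions *)
Definition is_moore_penrose (M G : 'End(V)) : Prop :=
  [/\ (M \o G \o M)%VF = M, (G \o M \o G)%VF = G,
      self_adjoint (M \o G)%VF & self_adjoint (G \o M)%VF].

Definition moore_penrose (M : 'End(V)) : 'End(V) := xget 0 [set G | is_moore_penrose M G].

End one_space.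

Section two_spaces.
Variables (V W : vectType R) (dV : {dot V for idfun}) (dW : {dot W for idfun}).

Definition is_adjoint (A : 'Hom(V, W)) (B : 'Hom(W, V)) : Prop :=
  forall v w, dW (A v) w = dV v (B w).

Definition adjoint (A : 'Hom(V, W)) : 'Hom(W, V) :=
  xget 0 [set B | is_adjoint A B].

End two_spaces.
End operators.

Section existence.
Context {R : realType}.

Lemma dot_eq0 (V : vectType R) (d : {dot V for idfun}) (v : V) :
  d v v = 0 -> v = 0.
Proof. by move/eqP; apply: contraTeq => /(@neq0_dnorm_gt0 _ _ _ d)/lt0r_neq0. Qed.

Lemma dot_inj (V : vectType R) (d : {dot V for idfun}) (u v : V) :
  (forall w, d w u = d w v) -> u = v.
Proof.
move=> /(_ (u - v)) e; apply/subr0_eq/(@dot_eq0 _ d).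
by rewrite linearBr /= e subrr.
Qed.

Lemma riesz (V : vectType R) (d : {dot V for idfun}) (phi : 'Hom(V, R^o)) :
  exists u, forall v, phi v = d v u.
Proof.
have dC u v : d u v = d v u by rewrite hermC expr0 mul1r.
pose F (u : V) : 'Hom(V, R^o) := linfun (d u : V -> R^o).
have FE u v : F u v = d u v by rewrite /F lfunE.
have Fl : linear F.
  by move=> a u v; apply/lfunP => w; rewrite add_lfunE scale_lfunE !FE linearPl.
pose F' : {linear V -> 'Hom(V, R^o)} := HB.pack F (GRing.isLinear.Build _ _ _ _ F Fl).
pose G := linfun F'.
have G0 : (lker G == 0)%VS.
  apply/lker0P => u v; rewrite !lfunE /= => /lfunP e.
  by apply: (@dot_inj _ d) => w; rewrite dC -FE e FE dC.
have : (limg G == fullv)%VS.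
  rewrite -(geq_leqif (dimv_leqif_eq (subvf _))) limg_dim_eq ?(eqP G0) ?capv0//.
  by rewrite !dimvf /dim /= muln1.
move=> /eqP /vspaceP /(_ phi); rewrite memvf => /memv_imgP[u _ ->].
by exists u => v; rewrite lfunE /= FE dC.
Qed.

Lemma adjointP (V W : vectType R) (dV : {dot V for idfun})
    (dW : {dot W for idfun}) (A : 'Hom(V, W)) :
  is_adjoint dV dW A (adjoint dV dW A).
Proof.
have dC u v : dW u v = dW v u by rewrite hermC expr0 mul1r.
have ex w : exists u, forall v, dW (A v) w = dV v u.
  have pl : linear (fun v => dW (A v) w : R^o).
    by move=> a u v; rewrite linearP linearPl.
  pose phi : {linear V -> R^o} :=
    HB.pack (fun v => dW (A v) w : R^o) (GRing.isLinear.Build _ _ _ _ _ pl).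
  have [u uP] := riesz dV (linfun phi).
  by exists u => v; rewrite -uP lfunE.
have /choice[B0 B0P] := ex.
have B0l : linear B0.
  move=> a u v; apply: (@dot_inj _ dV) => w.
  by rewrite linearPr /= -!B0P linearPr.
pose B1 : {linear W -> V} := HB.pack B0 (GRing.isLinear.Build _ _ _ _ _ B0l).
rewrite /adjoint; apply: (@xgetPex _ 0 [set B | is_adjoint dV dW A B]).
by exists (linfun B1) => v w; rewrite lfunE /= B0P.
Qed.

Lemma moore_penroseP (V : vectType R) (d : {dot V for idfun}) (M : 'End(V)) :
  self_adjoint d M -> is_moore_penrose d M (moore_penrose d M).
Proof.
move=> Msa; rewrite /moore_penrose; apply: (@xgetPex _ 0 [set G | is_moore_penrose d M G]).
have dC u v : d u v = d v u by rewrite hermC expr0 mul1r.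
have orth u v : u \in limg M -> v \in lker M -> d u v = 0.
  by move=> /memv_imgP[t _ ->]; rewrite memv_ker => /eqP Mv; rewrite Msa Mv linear0r.
have cap0 : (limg M :&: lker M)%VS = 0%VS.
  apply/eqP; rewrite -subv0; apply/subvP => v /memv_capP[vI vK].
  by rewrite memv0; apply/eqP/(@dot_eq0 _ d)/orth.
have sumT : (limg M + lker M)%VS = fullv.
  apply/eqP; rewrite -(geq_leqif (dimv_leqif_eq (subvf _))).
  rewrite dimv_disjoint_sum// addnC.
  by rewrite -(limg_ker_dim M fullv) capfv.
pose P := daddv_pi (limg M) (lker M); pose Q := daddv_pi (lker M) (limg M).
have PQ v : P v + Q v = v by apply: daddv_pi_add; rewrite ?sumT ?memvf.
have PI v : P v \in limg M by exact: memv_pi.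
have QK v : M (Q v) = 0 by apply/eqP; rewrite -memv_ker memv_pi.
have MP v : M (P v) = M v by rewrite -[in RHS](PQ v) linearD /= QK addr0.
have Pid v : v \in limg M -> P v = v by exact: daddv_pi_id.
have PK v : M v = 0 -> P v = 0.
  move=> Mv; apply/(@dot_eq0 _ d)/orth; first exact: PI.
  by rewrite memv_ker MP Mv.
have Psa u v : d (P u) v = d u (P v).
  have -> : d (P u) v = d (P u) (P v).
    by rewrite -[in LHS](PQ v) linearDr /= [X in _ + X]orth ?memv_pi ?addr0.
  by rewrite -[in RHS](PQ u) linearDl /= [d (Q u) _]dC [X in _ + X]orth ?memv_pi ?addr0.
pose G := (P \o M^-1 \o P)%VF.
have MG v : (M \o G)%VF v = P v.
  by rewrite !comp_lfunE MP limg_lfunVK.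
have GM v : (G \o M)%VF v = P v.
  rewrite !comp_lfunE (Pid (M v)) ?memv_img ?memvf//.
  apply/eqP; rewrite -subr_eq0 -linearB /= PK// linearB /= limg_lfunVK ?subrr//.
  by rewrite memv_img ?memvf.
exists G; split.
- by apply/lfunP => v; rewrite comp_lfunE MG Pid// memv_img ?memvf.
- by apply/lfunP => v; rewrite comp_lfunE GM Pid// !comp_lfunE.
- by move=> u v; rewrite !MG.
- by move=> u v; rewrite !GM.
Qed.

End existence.

Section convex_analysis.
Context {R : realType} {V : euclideanType R}.

(* The second conjunct says that [f] never takes the value -oo, so the sum on
   the right-hand side of the convexity inequality is never +oo - oo. *)
Definition closed_proper_convex (f : V -> \bar R) : Prop :=
  [/\ lower_semicontinuous f,
      (forall v, f v != -oo%E),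
      (exists v, f v != +oo%E) &
      forall (u v : V) (t : R), 0 < t < 1 ->
        (f (t *: u + (1 - t) *: v)%R <= t%:E * f u + (1 - t)%:E * f v)%E].

Definition subdiff (f : V -> \bar R) (v : V) : set V :=
  [set s | forall u, (f v + '[s, u - v]%:E <= f u)%E].

Definition grad (f : V -> R) (v : V) : V :=
  xget 0 [set s | forall h, 'd f v h = '[s, h]].

Definition convex_smooth (f : V -> R) : Prop :=
  [/\ convex_function setT f,
      (forall v, differentiable f v) &
      exists L : R, L.-lipschitz (grad f)].

Definition majorizes (f : V -> R) (S : 'End(V)) : Prop :=
  forall u v, f u <= f v + '[grad f v, u - v] + 2^-1 * sqnorm inner S (u - v).

End convex_analysis.

Section product_space.
Context {R : realType} {Y Z X : euclideanType R}.

Local Notation H := (Y * Z * X)%type.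

Definition innerH (w w' : H) : R :=
  '[w.1.1, w'.1.1] + '[w.1.2, w'.1.2] + '[w.2, w'.2].

Fact innerH_bilinear : bilinear_for ( *%R) (@idfun R \; *%R) innerH.
Proof.
split=> u a v w; rewrite /innerH /= ?linearPl ?linearPr /= !mulrDr;
  by rewrite [RHS]addrACA; congr (_ + _); rewrite addrACA.
Qed.

HB.instance Definition _ :=
  bilinear_isBilinear.Build R H H R ( *%R) (@idfun R \; *%R) innerH
    innerH_bilinear.

Fact innerH_sym w w' : innerH w w' = (-1) ^+ false * idfun (innerH w' w).
Proof.
by rewrite /innerH /= expr0 mul1r; do 2?congr (_ + _); rewrite hermC expr0 mul1r.
Qed.

HB.instance Definition _ :=
  isHermitianSesquilinear.Build R H false idfun innerH innerH_sym.

Fact inner_ge0 (E : euclideanType R) (v : E) : 0 <= '[v, v].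
Proof.
have [->|v0] := eqVneq v 0; first by rewrite linear0l.
exact/ltW/neq0_dnorm_gt0.
Qed.

Fact innerH_gt0 w : w != 0 -> 0 < innerH w w.
Proof.
case: w => [[y z] x]; rewrite /innerH /= => w0.
have [y0|y0] := eqVneq y 0; last first.
  by rewrite -addrA ltr_wpDr ?addr_ge0 ?inner_ge0// neq0_dnorm_gt0.
have [z0|z0] := eqVneq z 0; last first.
  by rewrite ltr_wpDr ?inner_ge0// ltr_wpDl ?inner_ge0// neq0_dnorm_gt0.
have x0 : x != 0 by apply: contra w0 => /eqP ->; rewrite y0 z0.
by rewrite ltr_wpDl ?addr_ge0 ?inner_ge0// neq0_dnorm_gt0.
Qed.

HB.instance Definition _ := isDotProduct.Build R H innerH innerH_gt0.

Definition normH (w : H) : R := Num.sqrt (innerH w w).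

End product_space.

Section operators_on_H.
Context {R : realType} {Y Z X : euclideanType R}.

Local Notation H := (Y * Z * X)%type.

Variables (p : Y -> \bar R) (f : Y -> R) (q : Z -> \bar R) (g : Z -> R).
Variables (A : 'Hom(Y, X)) (B : 'Hom(Z, X)) (c : X).
Variables (sigma : R) (Pf : 'End(Y)) (Pg : 'End(Z)).

Local Notation "A ^*" := (adjoint inner inner A) : ring_scope.

Definition Rns (w : H) : set H :=
  [set (u + A^* w.2, v + B^* w.2, - A w.1.1 - B w.1.2 + c)
     | u in subdiff p w.1.1 & v in subdiff q w.1.2].

Definition Fsm (w : H) : H := (grad f w.1.1, grad g w.1.2, 0).

Definition Rkkt (w : H) : set H := [set v + Fsm w | v in Rns w].

Definition kkt_solutions : set H := [set w | Rkkt w 0].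

Definition Mfun (w : H) : H :=
  (Pf w.1.1 + sigma *: A^* (A w.1.1) + A^* w.2,
   Pg w.1.2,
   A w.1.1 + sigma^-1 *: w.2).

Fact Mfun_linear : linear Mfun.
Proof.
move=> a u v; rewrite /Mfun /= !linearP /=; congr (_, _, _); rewrite /=.
  by rewrite !scalerDr [RHS]addrACA; congr (_ + _); rewrite addrACA.
by rewrite scalerDr addrACA.
Qed.

HB.instance Definition _ := GRing.isLinear.Build R H H *:%R Mfun Mfun_linear.

Definition Mop : 'End(H) := linfun Mfun.

(* [Tmap w] is the w+ with M w - Fsm w in M w+ + Rns w+ (0 if there is none). *)
Definition Tmap (w : H) : H :=
  xget 0 [set w' | [set Mop w' + v | v in Rns w'] (Mop w - Fsm w)].

End operators_on_H.

(* Main.v *)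
(* A preconditioned forward-backward argument with a degenerate (only
   semidefinite) preconditioner M. Differences of F := F_sm lie in Im M, so
   F w - F w* = M u with |u|_M^2 <= 2 beta <u, w - w*>_M. Monotonicity of
   R_ns and Young's inequality give the Fejer estimate
     |T w - w*|_M^2 <= |w - w*|_M^2 - (1 - beta) |w - T w|_M^2,
   but |.|_M is only a seminorm. What saves the ambient norm is that T is
   Lipschitz from |.|_M to the ambient norm: the input M w - F w of the
   resolvent depends on w nonexpansively in |.|_M, and eliminating x from the
   inclusion leaves strongly monotone inclusions in z (with operator
   P_g + sigma B^* B) and then in y (with operator P_f + sigma A^* A), so the
   resolvent is Lipschitz. Hence the orbit is bounded in the ambient norm, its
   cluster points are fixed points of T, i.e. KKT points, and the Fejer estimate
   relative to one of them forces convergence of the whole orbit. *)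
Require Import Defs.
From mathcomp Require Import all_boot all_order all_algebra.
From mathcomp Require Import all_classical all_reals all_analysis.
From mathcomp Require Import sesquilinear.
From mathcomp Require Import ring lra.
From HB Require Import structures.

Set Implicit Arguments.
Unset Strict Implicit.
Unset Printing Implicit Defensive.

Import Order.TTheory GRing.Theory Num.Theory.
Import numFieldNormedType.Exports VectorInternalTheory.

Local Open Scope classical_set_scope.
Local Open Scope ring_scope.

(** * Elementary inequalities over ordered fields *)

Lemma discriminant_le {R : realFieldType} (a b c : R) :
  0 <= c -> (forall t, 0 <= a + 2 * t * b + t ^+ 2 * c) -> b ^+ 2 <= a * c.
Proof.
rewrite le_eqVlt => /predU1P[<-{c}|c0] H.
  have [->|b0] := eqVneq b 0; first by rewrite expr0n mulr0.
  have := H (- (a + 1) / (2 * b)).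
  rewrite mulr0 addr0 (_ : 2 * _ * b = - (a + 1)); last by field.
  lra.
have := H (- b / c).
rewrite (_ : _ + _ = (a * c - b ^+ 2) / c); last by field; rewrite gt_eqF.
by rewrite pmulr_lge0 ?invr_gt0// subr_ge0.
Qed.

(** Combines two Cauchy-Schwarz bounds: the first gives [m <= (C + 1) * a], and then [a] cancels in
    the second. The factor [C + 1] avoids a square root of [C]. *)
Lemma le_mul_of_sqr_le {R : realFieldType} (a m k C : R) :
  0 <= a -> 0 <= k -> 0 <= C -> m ^+ 2 <= C * a ^+ 2 -> a ^+ 2 <= k * m ->
  a <= (C + 1) * k.
Proof.
move=> a0 k0 C0 mC akm.
have [->|aN0] := eqVneq a 0; first by rewrite mulr_ge0// addr_ge0.
have {}a0 : 0 < a by rewrite lt_neqAle eq_sym aN0.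
have ma : m <= (C + 1) * a.
  rewrite leNgt; apply/negP => lt_m.
  have : ((C + 1) * a) ^+ 2 < m ^+ 2.
    by rewrite ltrXn2r// ?nnegrE ?(ltW (le_lt_trans _ lt_m))// mulr_ge0// ?addr_ge0 ?(ltW a0).
  rewrite ltNge => /negP; apply; apply: le_trans mC _.
  by rewrite exprMn ler_wpM2r ?sqr_ge0//; nra.
rewrite -(ler_pM2r a0) -expr2; apply: le_trans akm _.
by rewrite mulrAC mulrC ler_wpM2r.
Qed.

(** * Quantitative linear algebra for an arbitrary dot product *)

Section dot.
Context {R : realType}.

Lemma dotC (V : vectType R) (d : {dot V for idfun}) u v : d u v = d v u.
Proof. by rewrite hermC expr0 mul1r. Qed.

Lemma dot_ge0 (V : vectType R) (d : {dot V for idfun}) u : 0 <= d u u.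
Proof.
have [->|u0] := eqVneq u 0; first by rewrite linear0l.
exact/ltW/neq0_dnorm_gt0.
Qed.

Lemma dotDD (V : vectType R) (d : {dot V for idfun}) u v :
  d (u + v) (u + v) = d u u + 2 * d u v + d v v.
Proof. by rewrite linearDl !linearDr /= (dotC d v u); ring. Qed.

Lemma dotD_le (V : vectType R) (d : {dot V for idfun}) u v :
  d (u + v) (u + v) <= 2 * d u u + 2 * d v v.
Proof.
have := dot_ge0 d (u - v); rewrite dotDD linearNr linearNl linearNr /= dotDD.
lra.
Qed.

Lemma dotZl (V : vectType R) (d : {dot V for idfun}) a u v :
  d (a *: u) v = a * d u v.
Proof. exact: linearZl_LR. Qed.

Lemma dotZr (V : vectType R) (d : {dot V for idfun}) a u v :
  d u (a *: v) = a * d u v.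
Proof. exact: linearZr_LR. Qed.

Lemma dotZZ (V : vectType R) (d : {dot V for idfun}) a u :
  d (a *: u) (a *: u) = a ^+ 2 * d u u.
Proof. by rewrite dotZl dotZr mulrA. Qed.

Lemma dotNN (V : vectType R) (d : {dot V for idfun}) u : d (- u) (- u) = d u u.
Proof. by rewrite linearNl linearNr /= opprK. Qed.

Lemma psd_cauchy_schwarz (V : vectType R) (d : {dot V for idfun}) (M : 'End(V)) :
  self_adjoint d M -> psd d M ->
  forall u v, d u (M v) ^+ 2 <= d u (M u) * d v (M v).
Proof.
move=> Msa M0 u v; apply: discriminant_le => // t.
have := M0 (u + t *: v); rewrite linearD linearZ /= linearDl !linearDr /=.
by rewrite !dotZl !dotZr -(Msa v u) [d (M v) u]dotC; lra.
Qed.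

Lemma cauchy_schwarz (V : vectType R) (d : {dot V for idfun}) u v :
  d u v ^+ 2 <= d u u * d v v.
Proof.
have := @psd_cauchy_schwarz V d \1%VF; rewrite /self_adjoint /psd.
under [X in (_ -> X -> _)]eq_forall do rewrite id_lfunE.
by move=> /(_ _ _ u v); rewrite !id_lfunE; apply=> *; rewrite ?id_lfunE// dot_ge0.
Qed.

(** [G] is a squared size of the source: the dot product in [lfun_bounded], the squared norm of
    coordinate rows in [dot_bolzano_weierstrass]. *)
Lemma dot_sum_bounded (W : vectType R) (d : {dot W for idfun}) (I : finType)
    (U : Type) (G : U -> R) (c : I -> U -> R) (e : I -> W) :
  (forall u, 0 <= G u) ->
  (forall i, exists C, forall u, c i u ^+ 2 <= C * G u) ->
  exists2 C : R, 0 < C & forall u,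
    d (\sum_i c i u *: e i) (\sum_i c i u *: e i) <= C * G u.
Proof.
move=> G0 cB.
suff [C CP] : exists C, forall u,
    d (\sum_i c i u *: e i) (\sum_i c i u *: e i) <= C * G u.
  exists (`|C| + 1); first by rewrite ltr_wpDl.
  move=> u; apply: le_trans (CP u) _; apply: ler_wpM2r => //.
  by rewrite (le_trans (ler_norm _))// lerDl.
(* Written as a sum of functions, the vector is open to [big_ind]: boundedness by [G] is stable
   under addition. *)
suff : exists C, forall u, d ((\sum_i (fun u => c i u *: e i)) u)
    ((\sum_i (fun u => c i u *: e i)) u) <= C * G u.
  by move=> [C CP]; exists C => u; have := CP u; rewrite fct_sumE.
pose P F := exists C, forall u : U, d (F u : W) (F u) <= C * G u.
rewrite -/(P _); apply: (big_ind P).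
- by exists 0 => u; rewrite linear0l mul0r.
- move=> F1 F2 [C1 H1] [C2 H2]; exists (2 * C1 + 2 * C2) => u.
  apply: le_trans (dotD_le _ _ _) _.
  by have := H1 u; have := H2 u; lra.
- move=> i _; have [C CP] := cB i; exists (C * d (e i) (e i)) => u.
  by rewrite /= dotZZ [leRHS]mulrAC ler_wpM2r ?dot_ge0.
Qed.

(** A coordinate is a linear functional; Cauchy-Schwarz against its Riesz vector bounds it. *)
Lemma v2r_bounded (V : vectType R) (d : {dot V for idfun}) i :
  exists C, forall u : V, (v2r u 0 i) ^+ 2 <= C * d u u.
Proof.
have pl : linear (fun u : V => v2r u 0 i : R^o).
  by move=> a u v; rewrite linearP !mxE.
pose phi : {linear V -> R^o} :=
  HB.pack (fun u : V => v2r u 0 i : R^o) (GRing.isLinear.Build _ _ _ _ _ pl).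
have [a aP] := riesz d (linfun phi).
exists (d a a) => u; have := aP u; rewrite lfunE /= => ->.
by rewrite mulrC cauchy_schwarz.
Qed.

Lemma lfun_bounded (V W : vectType R) (dV : {dot V for idfun})
    (dW : {dot W for idfun}) (L : 'Hom(V, W)) :
  exists2 C : R, 0 < C & forall u, dW (L u) (L u) <= C * dV u u.
Proof.
have LE u : L u = \sum_i v2r u 0 i *: L (r2v (delta_mx 0 i)).
  rewrite -[in LHS](v2rK u) {1}(row_sum_delta (v2r u)) !linear_sum /=.
  by apply: eq_bigr => i _; rewrite !linearZ.
have [C C0 CP] := @dot_sum_bounded _ dW _ _ (fun u => dV u u)
  (fun i u => v2r u 0 i) (fun i => L (r2v (delta_mx 0 i))) (dot_ge0 dV)
  (v2r_bounded dV).
by exists C => // u; rewrite !LE.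
Qed.

(** [V] carries no topology here, so compactness comes from a box of coordinate rows. Arbitrarily
    late close terms replace a subsequence. *)
Lemma dot_bolzano_weierstrass (V : vectType R) (d : {dot V for idfun})
    (s : nat -> V) C : (forall n, d (s n) (s n) <= C) ->
  exists u, forall e : R, 0 < e -> forall N, exists2 n, (N <= n)%N &
    d (s n - u) (s n - u) < e.
Proof.
move=> sC.
have /choice[K KP] i : exists K : R, forall n, `|v2r (s n) 0 i| <= K.
  have [K KP] := v2r_bounded d i; exists (1 + `|K| * C) => n.
  have C0 : 0 <= C by apply: le_trans (sC n); exact: dot_ge0.
  have K0 : K * d (s n) (s n) <= `|K| * C.
    apply: le_trans (_ : `|K| * d (s n) (s n) <= _).
      by rewrite ler_wpM2r ?dot_ge0// ler_norm.
    by rewrite ler_wpM2l.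
  have := KP (s n); rewrite -real_normK ?num_real//.
  by move: (normr_ge0 (v2r (s n) 0 i)) => *; nra.
have cpt : compact [set v : 'rV[R]_(dim V) | forall i, `[- K i, K i]%classic (v ord0 i)].
  by apply: (@rV_compact _ _ (fun i => `[- K i, K i]%classic)) => i; exact: segment_compact.
have [|r [_ rP]] := cpt ((fun n => v2r (s n)) @ \oo) _.
  by exists 0%N => // n _ i /=; rewrite in_itv /= -ler_norml.
have G0 (x : 'rV[R]_(dim V)) : 0 <= `|x| ^+ 2 by exact: sqr_ge0.
have [C1 C10 C1P] : exists2 C1 : R, 0 < C1 & forall x : 'rV[R]_(dim V),
    d (r2v x) (r2v x) <= C1 * `|x| ^+ 2.
  have [|C1 C10 C1P] := @dot_sum_bounded _ d _ _ (fun x : 'rV[R]_(dim V) => `|x| ^+ 2)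
    (fun i x => x 0 i) (fun i => r2v (delta_mx 0 i)) G0.
    move=> i; exists 1 => x; rewrite mul1r -real_normK ?num_real//.
    rewrite lerXn2r ?nnegrE// [leRHS]/Num.norm /= mx_normrE.
    by apply/bigmax_geP; right => /=; exists (0, i).
  exists C1 => // x; have := C1P x.
  suff -> : r2v x = \sum_i x 0 i *: r2v (delta_mx 0 i) by [].
  rewrite {1}(row_sum_delta x) linear_sum /=.
  by apply: eq_bigr => i _; rewrite linearZ.
exists (r2v r) => e e0 N.
(* [e' <= 1] keeps the squared coordinate distance below [e'], hence [C1] times it below [e]. *)
pose e' := Num.min 1 (e / C1).
have e'0 : 0 < e' by rewrite lt_min ltr01 divr_gt0.
have [||x [[n Nn <-]]] := rP [set v2r (s n) | n in [set n | (N <= n)%N]] (ball r e').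
- by exists N => // n /= Nn; exists n.
- exact: nbhsx_ballx.
rewrite -ball_normE /ball_ /= distrC => rn; exists n => //.
rewrite -(v2rK (s n)) -linearB /=; apply: le_lt_trans (C1P _) _.
have e'1 : e' <= 1 by rewrite /e' ge_min lexx.
have e'2 : C1 * e' <= e by rewrite mulrC -ler_pdivlMr// /e' ge_min lexx orbT.
apply: lt_le_trans e'2; rewrite ltr_pM2l//.
have := normr_ge0 (v2r (s n) - r); nra.
Qed.

(* Cauchy-Schwarz for the form [Q] applied to [u] and [Q^-1 u]. *)
Lemma pd_coercive (V : vectType R) (d : {dot V for idfun}) (Q : 'End(V)) :
  self_adjoint d Q -> pd d Q ->
  exists2 c : R, 0 < c & forall u, c * d u u <= d u (Q u).
Proof.
move=> Qsa Qpd.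
have Q0 : psd d Q.
  by move=> v; have [->|/Qpd/ltW//] := eqVneq v 0; rewrite linear0l.
have kQ : lker Q == 0%VS.
  rewrite -subv0; apply/subvP => v; rewrite memv_ker memv0 => /eqP Qv.
  by apply: contraT => /Qpd; rewrite Qv linear0r ltxx.
have [C C0 CP] := lfun_bounded d d (Q^-1)%VF.
have C1 : 0 < C + 1 by rewrite ltr_wpDr.
exists (C + 1)^-1 => [|u]; first by rewrite invr_gt0.
rewrite mulrC ler_pdivrMr// mulrC.
have QK : Q (Q^-1%VF u) = u by rewrite lker0_lfunVK.
have := psd_cauchy_schwarz Qsa Q0 u (Q^-1%VF u); rewrite QK.
apply: le_mul_of_sqr_le; rewrite ?dot_ge0 ?Q0 ?(ltW C0)//.
apply: le_trans (cauchy_schwarz d _ _) _.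
by rewrite expr2 mulrA ler_wpM2r// dot_ge0.
Qed.

(** Cauchy-Schwarz for the form [M] between [M u] and [u]: the seminorm of [u] controls the ambient
    norm of [M u] even if [M] is singular. *)
Lemma psd_image_bounded (V : vectType R) (d : {dot V for idfun}) (M : 'End(V)) :
  self_adjoint d M -> psd d M ->
  exists2 C : R, 0 < C & forall u, d (M u) (M u) <= C * d u (M u).
Proof.
move=> Msa M0; have [C C0 CP] := lfun_bounded d d M.
exists (C + 1) => [|u]; first by rewrite ltr_wpDr// ltW.
have := psd_cauchy_schwarz Msa M0 (M u) u; rewrite [leRHS]mulrC.
apply: le_mul_of_sqr_le; rewrite ?dot_ge0 ?M0 ?(ltW C0)//.
apply: le_trans (cauchy_schwarz d _ _) _.
by rewrite [leLHS]mulrC expr2 mulrA ler_wpM2r// dot_ge0.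
Qed.

End dot.

(** * Existence of resolvents of subdifferentials *)

Section resolvent.
Context {R : realType} {E : euclideanType R}.
Implicit Types (h : E -> \bar R) (u v : E).

Lemma norm_sqr_inner u : `|u| ^+ 2 = '[u, u].
Proof. by rewrite normE_inner sqr_sqrtr// inner_ge0. Qed.

Lemma inner_ge_norm u v : - (`|u| * `|v|) <= '[u, v].
Proof.
rewrite lerNl; apply: le_trans (ler_norm _) _; rewrite normrN.
rewrite -(@ler_pXn2r _ 2) ?nnegrE ?mulr_ge0// exprMn !norm_sqr_inner.
by rewrite real_normK ?num_real// cauchy_schwarz.
Qed.

Lemma nbhs_inner u (A : set E) : nbhs u A ->
  exists2 e : R, 0 < e & forall v, '[v - u, v - u] < e -> A v.
Proof.
move=> /nbhs_ballP[e /= e0 eA]; exists (e ^+ 2); first by rewrite exprn_gt0.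
move=> v; rewrite -norm_sqr_inner => ve; apply: eA.
rewrite -ball_normE /ball_ /= distrC.
by rewrite -(@ltr_pXn2r _ 2) ?nnegrE// ltW.
Qed.

(** Otherwise points of the ball with values tending to [-oo] would cluster at some [u], near which
    lower semicontinuity keeps [h] above a real number. *)
Lemma lsc_bounded_below h : lower_semicontinuous h -> (forall v, h v != -oo%E) ->
  forall r : R, exists K : R, forall u, '[u, u] <= r -> (K%:E <= h u)%E.
Proof.
move=> hlsc hNy r; apply: contrapT => /forallNP noK.
have /choice[s sP] (n : nat) : exists u, '[u, u] <= r /\ (h u < (- n%:R)%:E)%E.
  have /existsNP[u /not_implyP[ur /negP]] := noK (- n%:R).
  by rewrite -ltNge => hu; exists u.
have [u uP] := dot_bolzano_weierstrass (fun n => (sP n).1).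
have [a au] : exists a : R, (a%:E < h u)%E.
  case: (h u) (hNy u) => [b||]// _; last by exists 0; rewrite ltry.
  by exists (b - 1); rewrite lte_fin; lra.
have [A /nbhs_inner[e e0 eA] hA] := hlsc _ _ au.
have [n nN /eA/hA] := uP e e0 (Num.truncn (- a)).+1.
rewrite ltNge => /negP; apply; apply/ltW/(lt_le_trans (sP n).2).
rewrite lee_fin lerNl; apply/ltW/(lt_le_trans (truncnS_gt _)).
by rewrite ler_nat.
Qed.

(* The bound on the ball around a point [u0] of the domain is spread radially,
   applying convexity on the segment from [u0] to [u]. *)
Lemma convex_ge_linear h : closed_proper_convex h ->
  exists alpha, exists2 beta : R, 0 <= beta &
    forall u, ((alpha - beta * `|u|)%:E <= h u)%E.
Proof.
move=> [hlsc hNy [u0 hu0] hcvx].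
have [a ha] : exists a, h u0 = a%:E.
  by case: (h u0) hu0 (hNy u0) => // a; exists a.
(* By [dotD_le] this ball around [0] contains the unit ball around [u0]. *)
have [K KP] := lsc_bounded_below hlsc hNy (2 * '[u0, u0] + 2).
have Ka : K <= a.
  by rewrite -lee_fin -ha KP//; have := inner_ge0 u0; lra.
suff H u : ((K - (a - K) * `|u - u0|)%:E <= h u)%E.
  exists (K - (a - K) * `|u0|), (a - K) => [|u]; first by rewrite subr_ge0.
  apply: le_trans (H u); rewrite lee_fin.
  by have := ler_normB u u0; nra.
have [u1|u1] := leP `|u - u0| 1.
  apply: le_trans (KP u _).
    by rewrite lee_fin; have := normr_ge0 (u - u0); nra.
  rewrite -[in leLHS](subrK u0 u); apply: le_trans (dotD_le _ _ _) _.
  rewrite addrC lerD2l -norm_sqr_inner ler_piMr//.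
  by rewrite expr_le1.
case: (h u) (hNy u) (hcvx u u0) => [b||]// _; last by rewrite leey.
set N := `|u - u0| in u1 *.
have N0 : 0 < N by lra.
move=> /(_ N^-1); rewrite invr_gt0 N0 invf_lt1// u1 => /(_ isT).
rewrite ha => H.
(* The convex combination is at distance 1 from [u0], so [K] bounds [h] there. *)
have /le_trans/(_ H) : (K%:E <= h (N^-1 *: u + (1 - N^-1) *: u0)%R)%E.
  apply: KP; rewrite scalerBl scale1r addrCA -scalerBr.
  apply: le_trans (dotD_le _ _ _) _; rewrite lerD2l dotZZ -norm_sqr_inner.
  by rewrite -/N -exprMn mulVf ?gt_eqF// expr1n mulr1.
rewrite -!EFinM -EFinD !lee_fin => /(ler_wpM2l (ltW N0)).
rewrite mulrDr !mulrA mulrBr mulfV ?gt_eqF// mul1r mulr1.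
nra.
Qed.

(* [u] minimises [h + k] with [k u = <u, Q u> / 2 - <b, u>]; the infimum is taken
   over the reals [r] with [h u <= r - k u] to avoid sums in [\bar R]. *)
Lemma resolvent_exists h (Q : 'End(E)) : closed_proper_convex h ->
  self_adjoint inner Q -> pd inner Q -> forall b, exists u, subdiff h u (b - Q u).
Proof.
move=> hcpc Qsa Qpd b.
have [c c0 cP] := pd_coercive Qsa Qpd.
have [al [be be0 hge]] := convex_ge_linear hcpc.
have [hlsc hNy [u0 hu0] hcvx] := hcpc.
have [a0 ha0] : exists a, h u0 = a%:E.
  by case: (h u0) hu0 (hNy u0) => // a; exists a.
pose k u : R := 2^-1 * '[u, Q u] - '[b, u].
have kD u w : k (u + w) = k u + '[Q u - b, w] + 2^-1 * '[w, Q w].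
  rewrite /k linearD linearDl !linearDr /= linearDl /= linearNl /= -(Qsa w u).
  by rewrite (dotC _ (Q w) u) -(Qsa u w); lra.
pose S := [set r : R | exists u, (h u <= (r - k u)%:E)%E].
have Sge r u : (h u <= (r - k u)%:E)%E ->
    al - (be + `|b|) * `|u| + 2^-1 * c * `|u| ^+ 2 <= r.
  move=> /(le_trans (hge u)); rewrite lee_fin /k.
  have := cP u; rewrite -norm_sqr_inner.
  have := inner_ge_norm (- b) u; rewrite normrN linearNl /=; lra.
have c40 : 0 < c / 4 by lra.
(* Half of the quadratic term absorbs the linear one by completing the square; the other half keeps
   minimising sequences bounded. *)
have {Sge} Sge r u : (h u <= (r - k u)%:E)%E ->
    al - (be + `|b|) ^+ 2 / c + c / 4 * '[u, u] <= r.
  move=> /Sge; apply: le_trans; rewrite -norm_sqr_inner -subr_ge0.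
  set B := be + `|b|; set N := `|u|.
  rewrite [leRHS](_ : _ = c * (B / c - N / 2) ^+ 2).
    by rewrite mulr_ge0 ?sqr_ge0// ltW.
  by field; rewrite gt_eqF.
have Sinf : has_inf S.
  split; first by exists (a0 + k u0), u0; rewrite ha0 addrK.
  exists (al - (be + `|b|) ^+ 2 / c) => r [u /Sge]; apply: le_trans.
  by rewrite lerDl mulr_ge0 ?inner_ge0// ltW.
pose m := inf S.
have mP r u : (h u <= (r - k u)%:E)%E -> m <= r.
  by move=> hr; apply: ge_inf; [case: Sinf | exists u].
have /choice[s sP] (n : nat) : exists u, (h u <= ((m + n.+1%:R^-1) - k u)%:E)%E.
  have n0 : 0 < n.+1%:R^-1 :> R by rewrite invr_gt0.
  have [r [u ru] rm] := inf_adherent n0 Sinf; exists u.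
  by apply: le_trans ru _; rewrite lee_fin lerD2r ltW.
have sB n : '[s n, s n] <= (m + 1 - (al - (be + `|b|) ^+ 2 / c)) / (c / 4).
  rewrite ler_pdivlMr// mulrC lerBrDl; apply: le_trans (Sge _ _ (sP n)) _.
  by rewrite lerD2l invf_le1// ler1n.
have [u uP] := dot_bolzano_weierstrass sB.
(* The cluster point attains the infimum: if [h u] exceeded [m - k u + 2 * e], so would [h (s n)]
   for late [s n] near [u], but [k] drops by less than [e] there and the minimising error is below
   [e]. *)
have hu : (h u <= (m - k u)%:E)%E.
  rewrite leNgt; apply/negP => mu.
  have [e e0 eu] : exists2 e : R, 0 < e & ((m - k u + 2 * e)%:E < h u)%E.
    case: (h u) mu => [r||]//; last by exists 1; rewrite ?ltry.
    rewrite lte_fin => ?; exists ((r - (m - k u)) / 4); first by lra.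
    by rewrite lte_fin; lra.
  have [A /nbhs_inner[e1 e10 eA] hA] := hlsc _ _ eu.
  pose D := 1 + `|Q u - b|.
  have D0 : 0 < D by rewrite ltr_pwDl.
  have e20 : 0 < (e / D) ^+ 2 by rewrite exprn_gt0// divr_gt0.
  have e30 : 0 < Num.min e1 ((e / D) ^+ 2) by rewrite lt_min e10.
  have [n nN] := uP _ e30 (Num.truncn e^-1).+1.
  rewrite lt_min => /andP[/eA/hA sn]; rewrite -norm_sqr_inner.
  rewrite ltr_pXn2r ?nnegrE ?(ltW (divr_gt0 _ _))// ltr_pdivlMr// => snu.
  have := lt_le_trans sn (sP n); rewrite lte_fin.
  rewrite (_ : k (s n) = k (u + (s n - u))); last by rewrite addrC subrK.
  rewrite kD.
  have := inner_ge_norm (Q u - b) (s n - u).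
  have : 0 <= '[s n - u, Q (s n - u)].
    by apply: le_trans (cP _); rewrite mulr_ge0 ?inner_ge0// ltW.
  have : n.+1%:R^-1 < e.
    rewrite invf_plt ?posrE//; apply: lt_le_trans (truncnS_gt _) _.
    by rewrite ler_nat (leq_trans nN).
  move: snu; rewrite /D mulrDr mulr1.
  move: ('[_, _]) ('[_, _]) (n.+1%:R^-1) (normr_ge0 (s n - u)) => I q i N0.
  by move=> snu ie q0 I0 mi; suff : 2 * e < 2 * e; [rewrite ltxx | lra].
exists u => v /=.
have [a ha] : exists a, h u = a%:E.
  by case: (h u) hu (hNy u) => // a; exists a.
case hv : (h v) (hNy v) => [r||]// _; last by rewrite leey.
rewrite ha -EFinD lee_fin; move: hu; rewrite ha lee_fin => am.
(* Minimality of [u] against [u + t (v - u)], divided by [t]; letting [t] tend to 0 leaves the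
   subgradient inequality. *)
have key (t : R) : 0 < t < 1 -> 0 <= (r - a + '[Q u - b, v - u]) + t * (2^-1 * '[v - u, Q (v - u)]).
  move=> t01; have /andP[t0 t1] := t01.
  have := hcvx v u t t01; rewrite ha hv -!EFinM -EFinD.
  set w := _ + _ => hw.
  have : m <= t * r + (1 - t) * a + k w by apply: (@mP _ w); rewrite addrK.
  have -> : w = u + t *: (v - u) by rewrite /w scalerBl scale1r addrCA -scalerBr.
  have QZ : Q (t *: (v - u)) = t *: Q (v - u) by rewrite linearZ.
  rewrite kD QZ !dotZr dotZl => mw.
  rewrite -(pmulr_rge0 _ t0); lra.
rewrite -(opprB (Q u)) linearNl /= -subr_ge0.
rewrite [leRHS](_ : _ = r - a + '[Q u - b, v - u]); last by lra.
set x := _ + _ in key *; set y := 2^-1 * _ in key; clearbody x y.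
have [y0|y0] := leP y 0.
  by have := key 2^-1; nra.
rewrite leNgt; apply/negP => x0.
(* Makes [x + t * y <= x / 2 < 0], against [key]. *)
pose t := Num.min 2^-1 (- x / (2 * y)).
have t1 : t <= 2^-1 by rewrite /t ge_min lexx.
have t2 : t <= - x / (2 * y) by rewrite /t ge_min lexx orbT.
have t0 : 0 < t by rewrite /t lt_min invr_gt0 ltr0n divr_gt0 ?oppr_gt0// mulr_gt0.
have tt : 0 < t < 1 by rewrite t0; lra.
suff : x < x by rewrite ltxx.
have := key t tt; move: t2; rewrite ler_pdivlMr ?mulr_gt0//; by lra.
Qed.

End resolvent.

(** * Convergence of Fejer monotone orbits for a seminorm *)

Section fejer.
Context {R : realType} {V : vectType R} (d : {dot V for idfun}) (M : 'End(V)).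

Lemma sqnorm_bounded : exists2 K : R, 0 < K & forall u, sqnorm d M u <= K * d u u.
Proof.
have [C C0 CP] := lfun_bounded d d M; exists (1 + C) => [|u]; first by lra.
have := dot_ge0 d (u - M u); rewrite dotDD linearNr dotNN /= => h.
by have := CP u; have := dot_ge0 d u; have := dot_ge0 d (M u); rewrite /sqnorm; lra.
Qed.

(** Seminorm distances to fixed points decrease, so consecutive steps vanish in seminorm. The
    Lipschitz hypothesis turns seminorm bounds into ambient ones one iterate later, hence the
    shifted indices. *)
Lemma fejer_cvg (T : V -> V) (C kappa : R) :
  psd d M -> 0 < C -> 0 < kappa ->
  (forall w w', d (T w - T w') (T w - T w') <= C * sqnorm d M (w - w')) ->
  (forall w ws, T ws = ws ->
    sqnorm d M (T w - ws) <= sqnorm d M (w - ws) - kappa * sqnorm d M (w - T w)) ->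
  (exists ws, T ws = ws) ->
  forall w0, exists2 ws, T ws = ws &
    d (iter k T w0 - ws) (iter k T w0 - ws) @[k --> \oo] --> (0 : R).
Proof.
move=> M0 C0 k0 TC Tf [ws0 Tws0] w0.
have [K K0 KP] := sqnorm_bounded.
pose s k := iter k T w0.
have sS k : s k.+1 = T (s k) by [].
have am ws : T ws = ws ->
    {homo (fun k => sqnorm d M (s k - ws)) : m n / (m <= n)%N >-> n <= m}.
  move=> Tws; apply/nonincreasing_seqP => n; rewrite sS.
  apply: le_trans (Tf _ _ Tws) _; rewrite gerBl.
  by rewrite mulr_ge0 ?M0// ltW.
have step e : 0 < e -> exists N, forall n, (N <= n)%N -> sqnorm d M (s n - s n.+1) < e.
  move=> e0; pose a k := sqnorm d M (s k - ws0).
  have acvg : cvgn a.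
    apply: nonincreasing_is_cvgn; first exact: am.
    by exists 0 => _ [n _ <-]; exact: M0.
  have : (a n - a n.+1) @[n --> \oo] --> (0 : R).
    rewrite -(subrr (limn a)); apply: cvgB => //.
    by rewrite (cvg_shiftS a).
  move=> /cvgrPdist_lt/(_ (kappa * e)); rewrite mulr_gt0// => /(_ isT)[N _ NP].
  exists N => n /NP /=; rewrite sub0r normrN => h.
  rewrite -(ltr_pM2l k0); apply: le_lt_trans h; apply: le_trans (ler_norm _).
  by have := Tf (s n) ws0 Tws0; rewrite -sS /a; lra.
have sB k : d (s k.+1 - ws0) (s k.+1 - ws0) <= C * sqnorm d M (w0 - ws0).
  rewrite -{1 2}Tws0 sS; apply: le_trans (TC _ _) _.
  by rewrite ler_pM2l//; have := am ws0 Tws0 0%N k (leq0n k).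
have [u uP] := dot_bolzano_weierstrass sB.
pose w := u + ws0.
have wP e : 0 < e -> forall N, exists2 n, (N <= n)%N & d (s n.+1 - w) (s n.+1 - w) < e.
  by move=> e0 N; have [n Nn h] := uP e e0 N; exists n => //; rewrite opprD addrA addrAC.
have Tw : T w = w.
  apply/subr0_eq/(@dot_eq0 _ _ d)/eqP; rewrite eq_le dot_ge0 andbT.
  apply/ler_addgt0Pl => e e0; rewrite addr0.
  (* Two uses of [dotD_le] on the three-term splitting of [T w - w] below give
     [4 * (C * K) + 4 * C + 2] times [e / D]. *)
  pose D := 4 * (C * K) + 4 * C + 2.
  have D0 : 0 < D by have := mulr_gt0 C0 K0; rewrite /D; lra.
  have e1 : 0 < e / D by rewrite divr_gt0.
  have [N NP] := step _ e1; have [n Nn h3] := wP _ e1 N.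
  have h2 := NP n Nn.
  rewrite (_ : T w - w = ((T w - T (s n.+1)) + (T (s n.+1) - s n.+1)) + (s n.+1 - w));
    last by rewrite !subrKA.
  set x := e / D in e1 h2 h3.
  have q1 : d (T w - T (s n.+1)) (T w - T (s n.+1)) <= C * (K * x).
    apply: le_trans (TC _ _) _; rewrite ler_pM2l//.
    apply: le_trans (KP _) _; rewrite ler_pM2l//.
    by rewrite -opprB dotNN ltW.
  have q2 : d (T (s n.+1) - s n.+1) (T (s n.+1) - s n.+1) <= C * x.
    rewrite {2 4}sS -opprB dotNN; apply: le_trans (TC _ _) _.
    by rewrite ler_pM2l// ltW.
  apply: le_trans (dotD_le _ _ _) _.
  have := dotD_le d (T w - T (s n.+1)) (T (s n.+1) - s n.+1).
  have -> : e = D * x by rewrite mulrC divfK// gt_eqF.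
  by rewrite /D; lra.
exists w => //; apply/cvgrPdist_lt => e e0.
(* A factor [K] is lost in passing to the seminorm, where closeness persists by monotonicity, and a
   factor [C] in returning through [T]. *)
have e1 : 0 < e / (C * K) by rewrite divr_gt0// mulr_gt0.
have [n _ nP] := wP _ e1 0%N.
exists n.+2 => // -[//|k] /= nk.
rewrite sub0r normrN ger0_norm ?dot_ge0// -/(s k) -{1 2}Tw.
apply: le_lt_trans (TC _ _) _.
rewrite mulrC -ltr_pdivlMr//.
apply: le_lt_trans (am w Tw n.+1 k nk) _; apply: le_lt_trans (KP _) _.
by rewrite mulrC -ltr_pdivlMr// -mulrA -invfM.
Qed.

End fejer.

(** * Forward-backward iteration with a semidefinite preconditioner *)

(* [T] stands for [(M + Rm)^-1 (M - F)]; it is not computed but characterised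
   by [T_inclusion]. *)
Section preconditioned_forward_backward.
Context {R : realType} {V : vectType R} (d : {dot V for idfun}) (M : 'End(V)).
Variables (Rm : V -> set V) (F T : V -> V) (beta : R).
Hypotheses (M_sa : self_adjoint d M) (M_psd : psd d M).
Hypothesis Rm_monotone : forall w w' r r',
  Rm w r -> Rm w' r' -> 0 <= d (r - r') (w - w').
Hypothesis resolvent_lip : exists2 C : R, 0 < C &
  forall w w' v v', Rm w (v - M w) -> Rm w' (v' - M w') ->
    d (w - w') (w - w') <= C * d (v - v') (v - v').
Hypothesis T_inclusion : forall w, Rm (T w) (M w - F w - M (T w)).
Hypothesis beta01 : 0 < beta < 1.
Hypothesis F_cocoercive : forall w w',
  F w - F w' \in limg M /\
  (2 * beta)^-1 * sqnorm d (moore_penrose d M) (F w - F w')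
    <= d (F w - F w') (w - w').

(** Conversely, [w] and [T w] solve the resolvent inclusion with the same input, so the Lipschitz
    bound identifies them. *)
Lemma fixed_point_inclusion w : T w = w <-> Rm w (- F w).
Proof.
split=> [Tw|RF]; first by have := T_inclusion w; rewrite Tw addrAC subrr add0r.
have [C C0 CP] := resolvent_lip.
apply/subr0_eq/(@dot_eq0 _ _ d)/eqP; rewrite eq_le dot_ge0 andbT.
have := CP _ w _ (M w - F w) (T_inclusion w).
by rewrite subrr linear0l mulr0; apply; rewrite addrAC subrr add0r.
Qed.

(** [u] is the pseudoinverse of [M] applied to [F w - F w']. As that difference lies in the range of
    [M], [M u] recovers it, and its pseudoinverse norm is the seminorm of [u]. *)
Lemma cocoercive_preimage w w' : exists2 u,
  M u = F w - F w' & d u (M u) <= 2 * beta * d u (M (w - w')).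
Proof.
have [FM Fle] := F_cocoercive w w'; have /andP[b0 b1] := beta01.
have [MGM _ _ _] := moore_penroseP M_sa.
move: FM Fle; set dF := F w - F w' => FM Fle.
have MG : M (moore_penrose d M dF) = dF.
  by case/memv_imgP: FM => v _ ->; rewrite -[in RHS]MGM !comp_lfunE.
exists (moore_penrose d M dF) => //; rewrite -!M_sa MG.
by rewrite mulrC -ler_pdivrMr ?mulr_gt0// mulrC.
Qed.

(** The resolvent inputs differ by [M (w - w' - u)], and subtracting [u] does not increase the
    seminorm, because [beta < 1]. *)
Lemma T_lipschitz : exists2 C : R, 0 < C & forall w w',
  d (T w - T w') (T w - T w') <= C * sqnorm d M (w - w').
Proof.
have [C C0 CP] := resolvent_lip; have [K K0 KP] := psd_image_bounded M_sa M_psd.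
exists (C * K) => [|w w']; first exact: mulr_gt0.
have /andP[b0 b1] := beta01.
have [u uF uP] := cocoercive_preimage w w'.
apply: le_trans (CP _ _ _ _ (T_inclusion w) (T_inclusion w')) _.
rewrite -mulrA ler_pM2l//.
have -> : M w - F w - (M w' - F w') = M (w - w' - u).
  by apply: (@dot_inj _ _ d) => v; rewrite !linearB /= uF !linearB /=; ring.
apply: le_trans (KP _) _; rewrite ler_pM2l// /sqnorm.
set e := w - w' in uP *.
rewrite linearB linearBl !linearBr /= -[d e (M u)]M_sa (dotC d (M e)).
have u0 : 0 <= d u (M u) by exact: M_psd.
have ub : beta * d u (M e) <= d u (M e).
  rewrite ler_piMl ?(ltW b1)//; have := le_trans u0 uP.
  by rewrite pmulr_rge0//; lra.
lra.
Qed.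

(* Young's inequality, in the form [0 <= |u - beta (w - T w)|_M ^ 2], absorbs
   the cross term between [F w - F ws = M u] and [w - T w]. *)
Lemma T_fejer w ws : T ws = ws ->
  sqnorm d M (T w - ws) <=
    sqnorm d M (w - ws) - (1 - beta) * sqnorm d M (w - T w).
Proof.
move=> Tws; have /andP[b0 b1] := beta01.
have [u uF uP] := cocoercive_preimage w ws.
have := Rm_monotone (T_inclusion w) (T_inclusion ws); rewrite Tws.
set t := T w - ws; set e := w - T w.
have we : w - ws = t + e by rewrite [RHS]addrC /t /e subrKA.
have -> : M w - F w - M (T w) - (M ws - F ws - M ws) = M (e - u).
  apply: (@dot_inj _ _ d) => v; rewrite /e !linearB /= uF !linearB /=; ring.
have M2 a b : d a (M b) = d b (M a) by rewrite -M_sa dotC.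
clearbody t e; rewrite M_sa linearBl /= => mono.
have ML a b : M (a + b) = M a + M b by rewrite linearD.
rewrite we ML linearDr /= in uP.
rewrite we.
have -> : sqnorm d M (t + e) = d t (M t) + 2 * d t (M e) + d e (M e).
  by rewrite /sqnorm ML linearDr /= !linearDl /= (M2 e t); ring.
rewrite /sqnorm.
have : 0 <= d u (M u) - 2 * beta * d u (M e) + beta ^+ 2 * d e (M e).
  apply: le_trans (M_psd (u - beta *: e)) _; rewrite le_eqVlt; apply/predU1P; left.
  have -> : M (u - beta *: e) = M u - beta *: M e by rewrite linearB linearZ.
  by rewrite linearBl !linearBr /= !dotZl !dotZr (M2 e u); ring.
move=> young; rewrite (M2 e t) in mono.
have bmono := mulr_ge0 (ltW b0) mono.
(* Adds [young], [uP] and twice [bmono], which eliminates [u]; cancelling [beta] bounds the cross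
   term of [t + e] from below. *)
have : 0 <= beta * (2 * d t (M e) + beta * d e (M e)) by lra.
by rewrite pmulr_rge0//; lra.
Qed.

Theorem preconditioned_forward_backward_cvg : (exists ws, Rm ws (- F ws)) ->
  forall w0, exists2 ws, Rm ws (- F ws) &
    d (iter k T w0 - ws) (iter k T w0 - ws) @[k --> \oo] --> (0 : R).
Proof.
move=> [ws0 ws0P] w0; have [C C0 CP] := T_lipschitz.
have [||ws /fixed_point_inclusion ws1 ws2] :=
  fejer_cvg M_psd C0 (_ : 0 < 1 - beta) CP T_fejer _ w0.
- by have := beta01; lra.
- by exists ws0; apply/fixed_point_inclusion.
- by exists ws.
Qed.

End preconditioned_forward_backward.

(** * Monotone inclusions and bounds on their solutions *)

Section monotone.
Context {R : realType}.

Lemma subdiff_monotone {E : euclideanType R} (h : E -> \bar R) u u' s s' :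
  closed_proper_convex h -> subdiff h u s -> subdiff h u' s' ->
  0 <= '[s - s', u - u'].
Proof.
move=> [_ hNy [v hv] _].
(* A subgradient at [w] forces [h w] to be finite, since [h] is finite at [v]. *)
have fin w r : subdiff h w r -> exists a, h w = a%:E.
  move=> /(_ v); case: (h w) (hNy w) => [a||]// _; first by exists a.
  by case: (h v) hv.
move=> su su'; have [a ha] := fin _ _ su; have [a' ha'] := fin _ _ su'.
have := su u'; have := su' u; rewrite ha ha' -!EFinD !lee_fin.
rewrite !linearBr /= !linearBl /=; lra.
Qed.

(** For use on the difference of two solutions of an inclusion in [Q] plus a subdifferential, where
    monotonicity supplies the premise. Coercivity and Young's inequality then give the bound. *)
Lemma coercive_solution_bound (V : vectType R) (d : {dot V for idfun})
    (Q : 'End(V)) : self_adjoint d Q -> pd d Q ->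
  exists2 K : R, 0 < K &
    forall r u, 0 <= d (r - Q u) u -> d u u <= K * d r r.
Proof.
move=> Qsa Qpd; have [c c0 cP] := pd_coercive Qsa Qpd.
exists (c^-1 ^+ 2) => [|r u]; first by rewrite exprn_gt0// invr_gt0.
rewrite linearBl /= (dotC d (Q u)) => h.
have := dot_ge0 d (c^-1 *: r - u).
rewrite dotDD dotZZ dotNN linearNr /= dotZl => h'.
have h2 : d u u <= c^-1 * d u (Q u) by rewrite mulrC ler_pdivlMr// mulrC.
have : c^-1 * d u (Q u) <= c^-1 * d r u.
  by rewrite ler_pM2l ?invr_gt0//; lra.
lra.
Qed.

End monotone.

(** * The KKT operator, its preconditioner and the resolvent *)

Section kkt.
Context {R : realType} {Y Z X : euclideanType R}.
Variables (p : Y -> \bar R) (q : Z -> \bar R).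
Variables (A : 'Hom(Y, X)) (B : 'Hom(Z, X)) (c : X).
Variables (sigma : R) (Pf : 'End(Y)) (Pg : 'End(Z)) (f : Y -> R) (g : Z -> R).
Hypotheses (pcpc : closed_proper_convex p) (qcpc : closed_proper_convex q).
Hypotheses (sigma_gt0 : 0 < sigma).
Hypotheses (Pf_sa : self_adjoint inner Pf) (Pg_sa : self_adjoint inner Pg).
Hypotheses (Pf_psd : psd inner Pf) (Pg_psd : psd inner Pg).

Local Notation H := (Y * Z * X)%type.
Local Notation "A ^*" := (adjoint inner inner A) : ring_scope.
Local Notation M := (Mop A sigma Pf Pg).
Local Notation Rns := (Rns p q A B c).
Local Notation T := (Tmap p f q g A B c sigma Pf Pg).

Lemma inner_adjoint {V W : euclideanType R} (L : 'Hom(V, W)) v w :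
  '[v, L^* w] = '[L v, w].
Proof. by rewrite (adjointP inner inner L). Qed.

Lemma inner_adjointl {V W : euclideanType R} (L : 'Hom(V, W)) v w :
  '[L^* w, v] = '[w, L v].
Proof. by rewrite dotC inner_adjoint dotC. Qed.

Lemma add_normal_self_adjoint {V : euclideanType R} (P : 'End(V)) (L : 'Hom(V, X)) :
  self_adjoint inner P -> self_adjoint inner (P + sigma *: (L^* \o L)%VF).
Proof.
move=> Psa u v; rewrite !add_lfunE !scale_lfunE !comp_lfunE linearDl linearDr /=.
by rewrite dotZl dotZr inner_adjoint inner_adjointl Psa.
Qed.

Lemma dotHE (u v : H) : (innerH : {dot H for idfun}) u v =
  '[u.1.1, v.1.1] + '[u.1.2, v.1.2] + '[u.2, v.2].
Proof. by []. Qed.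

Lemma MopE w : M w = Mfun A sigma Pf Pg w.
Proof. by rewrite lfunE. Qed.

Lemma Mop_self_adjoint : self_adjoint innerH M.
Proof.
move=> [[y z] x] [[y' z'] x']; rewrite !MopE !dotHE /=.
rewrite !linearDl !linearDr /= !dotZl !dotZr !inner_adjoint !inner_adjointl.
by rewrite Pf_sa Pg_sa; ring.
Qed.

(** Completing the square merges [sigma A^* A], the off-diagonal blocks and [sigma^-1 I] into one
    square. *)
Lemma Mop_psd : psd innerH M.
Proof.
move=> [[y z] x]; rewrite !MopE dotHE /=.
rewrite (_ : _ + _ = '[y, Pf y] + '[z, Pg z]
    + sigma * '[A y + sigma^-1 *: x, A y + sigma^-1 *: x]).
  by rewrite !addr_ge0 ?Pf_psd ?Pg_psd// mulr_ge0 ?(ltW sigma_gt0)// inner_ge0.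
rewrite dotDD dotZZ !linearDr /= !dotZr !inner_adjoint (dotC _ x (A y)).
by field; rewrite gt_eqF.
Qed.

Lemma RnsP w r : Rns w r <->
  [/\ subdiff p w.1.1 (r.1.1 - A^* w.2), subdiff q w.1.2 (r.1.2 - B^* w.2)
    & r.2 = - A w.1.1 - B w.1.2 + c].
Proof.
split=> [[u pu [v qv <-]] /=|[pu qv r2]]; first by rewrite !addrK.
exists (r.1.1 - A^* w.2) => //; exists (r.1.2 - B^* w.2) => //.
by rewrite !subrK -r2 -!surjective_pairing.
Qed.

(** The linear part of [Rns] is skew, so only the two subdifferentials contribute. *)
Lemma Rns_monotone w w' r r' : Rns w r -> Rns w' r' ->
  0 <= innerH (r - r') (w - w').
Proof.
move=> /RnsP[pr qr r2] /RnsP[pr' qr' r2'].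
have := subdiff_monotone pcpc pr pr'; have := subdiff_monotone qcpc qr qr'.
rewrite /innerH /= r2 r2' => h1 h2.
apply: le_trans (addr_ge0 h1 h2) _; rewrite le_eqVlt; apply/orP; left; apply/eqP.
rewrite !linearBl /= !linearDl /= !linearBr /= !linearNl /= !inner_adjointl.
rewrite !(dotC _ (A _)) !(dotC _ (B _)).
by ring.
Qed.

Hypotheses (Qf_pd : pd inner (Pf + sigma *: (A^* \o A)%VF)).
Hypotheses (Qg_pd : pd inner (Pg + sigma *: (B^* \o B)%VF)).

(** In the third row [A y] cancels, so [x] depends on [z] and the input only. This bounds [z] first,
    then [x], then [y]. *)
Lemma resolvent_lipschitz : exists2 C : R, 0 < C &
  forall w w' v v' : H, Rns w (v - M w) -> Rns w' (v' - M w') ->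
    innerH (w - w') (w - w') <= C * innerH (v - v') (v - v').
Proof.
have [Kf Kf0 KfP] := coercive_solution_bound (add_normal_self_adjoint A Pf_sa) Qf_pd.
have [Kg Kg0 KgP] := coercive_solution_bound (add_normal_self_adjoint B Pg_sa) Qg_pd.
have [a a0 aP] := lfun_bounded inner inner (A^*).
have [b b0 bP] := lfun_bounded inner inner B.
have [b' b'0 b'P] := lfun_bounded inner inner (B^*).
(* The 2s come from [dotD_le]; the 8 is one of them times the square of the factor in
   [2 *: A^* x]. *)
pose Cz := Kg * (2 + 2 * (sigma ^+ 2 * b')).
pose Cx := sigma ^+ 2 * (2 + 2 * (b * Cz)).
pose Cy := Kf * (2 + 8 * (a * Cx)).
have s20 : 0 < sigma ^+ 2 by rewrite exprn_gt0.
have Cz0 : 0 < Cz by rewrite mulr_gt0// addr_gt0// mulr_gt0// mulr_gt0.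
have Cx0 : 0 < Cx by rewrite mulr_gt0// addr_gt0// mulr_gt0// mulr_gt0.
have Cy0 : 0 < Cy by rewrite mulr_gt0// addr_gt0// mulr_gt0// mulr_gt0.
exists (Cy + Cz + Cx) => [|w w' v v' /RnsP[pw qw w2] /RnsP[pw' qw' w2']].
  by rewrite !addr_gt0.
have := subdiff_monotone pcpc pw pw'; have := subdiff_monotone qcpc qw qw'.
move: w2 w2'; rewrite !MopE /innerH /=.
set a1 := v.1.1 - v'.1.1; set a2 := v.1.2 - v'.1.2; set a3 := v.2 - v'.2.
set y := w.1.1 - w'.1.1; set z := w.1.2 - w'.1.2; set x := w.2 - w'.2.
move=> e e'.
have xE : x = sigma *: (a3 + B z).
  apply: (@dot_inj _ _ inner) => t.
  have := congr1 (inner t) e; have := congr1 (inner t) e'.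
  rewrite !linearBr /= => /(canRL (subrK _)) e2' /(canRL (subrK _)) e2.
  rewrite /x /a3 /z dotZr !(linearB, linearD) /= e2 e2'.
  rewrite !linearDr !linearNr /= !dotZr.
  by field; rewrite gt_eqF.
set h1 := (X in '[X, z]); set h2 := (X in '[X, y]).
(* Substituting [xE] into [B^* x] produces the term [sigma B^* B] absent from the [z] block of
   [M]. *)
rewrite (_ : h1 = (a2 - sigma *: B^* a3) - (Pg + sigma *: (B^* \o B)%VF) z); last first.
  rewrite /h1 -/z; apply: (@dot_inj _ _ inner) => t.
  rewrite !add_lfunE !scale_lfunE !comp_lfunE /= !linearBr !linearDr /=.
  rewrite !dotZr !inner_adjoint.
  have -> : '[B t, w.2] = '[B t, w'.2] + sigma * '[B t, a3] + sigma * '[B t, B z].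
    by rewrite -[w.2](subrK w'.2) -/x xE linearDr /= dotZr linearDr /=; ring.
  by rewrite /a2 /z !linearB /=; ring.
move=> /KgP zB.
(* [A^* x] occurs both in [M w] and in [Rns w], hence the factor [2] *)
rewrite (_ : h2 = (a1 - 2 *: A^* x) - (Pf + sigma *: (A^* \o A)%VF) y); last first.
  rewrite /h2; apply: (@dot_inj _ _ inner) => t.
  rewrite !add_lfunE !scale_lfunE !comp_lfunE /= !linearBr !linearDr /=.
  by rewrite !dotZr !inner_adjoint /a1 /y /x !linearB /=; ring.
move=> /KfP yB.
set N := _ + _ + '[a3, a3].
have [N1 N2 N3] : [/\ '[a1, a1] <= N, '[a2, a2] <= N & '[a3, a3] <= N].
  rewrite /N; move: (inner_ge0 a1) (inner_ge0 a2) (inner_ge0 a3).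
  by move: ('[a1, a1]) ('[a2, a2]) ('[a3, a3]) => *; split; lra.
have zN : '[z, z] <= Cz * N.
  apply: le_trans zB _; rewrite /Cz -mulrA ler_pM2l//.
  apply: le_trans (dotD_le _ _ _) _; rewrite dotNN dotZZ.
  have : sigma ^+ 2 * '[B^* a3, B^* a3] <= sigma ^+ 2 * (b' * N).
    by rewrite ler_pM2l//; apply: le_trans (b'P _) _; rewrite ler_pM2l.
  by move: N2; lra.
have xN : '[x, x] <= Cx * N.
  rewrite {1 2}xE dotZZ /Cx -mulrA ler_pM2l//.
  apply: le_trans (dotD_le _ _ _) _.
  have : '[B z, B z] <= b * (Cz * N).
    by apply: le_trans (bP _) _; rewrite ler_pM2l.
  by move: N3; lra.
have yN : '[y, y] <= Cy * N.
  apply: le_trans yB _; rewrite /Cy -mulrA ler_pM2l//.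
  apply: le_trans (dotD_le _ _ _) _; rewrite dotNN dotZZ.
  have : '[A^* x, A^* x] <= a * (Cx * N).
    by apply: le_trans (aP _) _; rewrite ler_pM2l.
  by move: N1; lra.
by rewrite !mulrDl !lerD.
Qed.

(** The same elimination run forwards: [z] from its own inclusion, [x] from the third row, then
    [y]. *)
Lemma resolvent_inclusion (v : H) : exists w, Rns w (v - M w).
Proof.
have [z zP] := resolvent_exists qcpc (add_normal_self_adjoint B Pg_sa) Qg_pd
  (v.1.2 - sigma *: B^* (v.2 - c)).
pose x := sigma *: (v.2 + B z - c).
have [y yP] := resolvent_exists pcpc (add_normal_self_adjoint A Pf_sa) Qf_pd
  (v.1.1 - 2 *: A^* x).
exists (y, z, x); apply/RnsP; rewrite MopE /=; split.
- rewrite (_ : _ - _ = v.1.1 - 2 *: A^* x - (Pf + sigma *: (A^* \o A)%VF) y)//.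
  apply: (@dot_inj _ _ inner) => t.
  rewrite !add_lfunE !scale_lfunE !comp_lfunE !(linearB, linearD) /=.
  by rewrite !dotZr; ring.
- rewrite (_ : _ - _ = v.1.2 - sigma *: B^* (v.2 - c) - (Pg + sigma *: (B^* \o B)%VF) z)//.
  apply: (@dot_inj _ _ inner) => t.
  rewrite !add_lfunE !scale_lfunE !comp_lfunE /x !(linearB, linearD) /=.
  rewrite !dotZr !inner_adjoint !dotZr.
  by ring.
- apply: (@dot_inj _ _ inner) => t.
  rewrite /x scalerA mulVf ?gt_eqF// scale1r !(linearB, linearD, linearN) /=.
  by ring.
Qed.

(** Existence of a resolvent point rules out the default value [0] of [xget]. *)
Lemma Tmap_inclusion w : Rns (T w) (M w - Fsm f g w - M (T w)).
Proof.
have [w' w'P] := resolvent_inclusion (M w - Fsm f g w).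
have [r Rr <-] : [set M (T w) + r | r in Rns (T w)] (M w - Fsm f g w).
  apply: (@xgetPex _ 0 [set w' | [set M w' + r | r in Rns w'] (M w - Fsm f g w)]).
  by exists w', (M w - Fsm f g w - M w') => //; rewrite addrC subrK.
by rewrite addrC addKr.
Qed.

End kkt.

(** * Convergence of the iterates of [Tmap] to a KKT point *)

Theorem theorem3p7 (R : realType) (Y Z X : euclideanType R)
    (p : Y -> \bar R) (f : Y -> R) (q : Z -> \bar R) (g : Z -> R)
    (A : 'Hom(Y, X)) (B : 'Hom(Z, X)) (c : X)
    (Sigma_f S : 'End(Y)) (Sigma_g T : 'End(Z)) (sigma beta : R)
    (hp : closed_proper_convex p) (hq : closed_proper_convex q)
    (hf : convex_smooth f) (hg : convex_smooth g)
    (hSigma_f : self_adjoint inner Sigma_f) (hSigma_f0 : psd inner Sigma_f)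
    (hSigma_g : self_adjoint inner Sigma_g) (hSigma_g0 : psd inner Sigma_g)
    (hmaj_f : majorizes f Sigma_f) (hmaj_g : majorizes g Sigma_g)
    (hS : self_adjoint inner S) (hT : self_adjoint inner T)
    (hsigma : 0 < sigma) :
  let Pf : 'End(Y) := S + Sigma_f in
  let Pg : 'End(Z) := T + Sigma_g in
  let M := Mop A sigma Pf Pg in
  let Omega := kkt_solutions p f q g A B c in
  Omega !=set0 ->
  psd inner Pf ->
  psd inner Pg ->
  pd inner (Pf + sigma *: (adjoint inner inner A \o A)%VF) ->
  pd inner (Pg + sigma *: (adjoint inner inner B \o B)%VF) ->
  0 < beta < 1 ->
  (forall w1 w2 : Y * Z * X,
     let dw : Y * Z * X := w1 - w2 in
     let dF : Y * Z * X := Fsm f g w1 - Fsm f g w2 in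
     dF \in limg M /\
     innerH dF dw >= (2 * beta)^-1 * sqnorm innerH (moore_penrose innerH M) dF) ->
  forall w0 : Y * Z * X,
    exists2 wstar, Omega wstar &
      normH (iter k (Tmap p f q g A B c sigma Pf Pg) w0 - wstar)
        @[k --> \oo] --> (0 : R).
Proof.
move=> Pf Pg M Omega [ws0 ws0P] Pf0 Pg0 Qf Qg beta01 hF w0.
have saD (V : euclideanType R) (P Q : 'End(V)) :
    self_adjoint inner P -> self_adjoint inner Q -> self_adjoint inner (P + Q).
  by move=> hP hQ u v; rewrite !add_lfunE linearDl linearDr /= hP hQ.
have Pf_sa : self_adjoint inner Pf by exact: saD.
have Pg_sa : self_adjoint inner Pg by exact: saD.
have OmegaP w : Omega w <-> Rns p q A B c w (- Fsm f g w).
  split=> [[r Rr /addr0_eq <-]|RF]; first by rewrite opprK.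
  by exists (- Fsm f g w); rewrite ?addNr.
have M_sa : self_adjoint innerH M by exact: Mop_self_adjoint.
have M_psd : psd innerH M by exact: Mop_psd.
have Rlip := resolvent_lipschitz c hp hq hsigma Pf_sa Pg_sa Qf Qg.
have Tin := Tmap_inclusion c f g hp hq hsigma Pf_sa Pg_sa Qf Qg.
have [|ws /OmegaP wsP wsC] := preconditioned_forward_backward_cvg
  M_sa M_psd (Rns_monotone hp hq) Rlip Tin beta01 hF _ w0.
  by exists ws0; apply/OmegaP.
(* The limit is known for squared norms; continuity of the square root at 0 transfers it. *)
exists ws => //; rewrite -(@sqrtr0 R).
exact: (continuous_cvg _ (@sqrt_continuous R 0) wsC).
Qed.
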